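(* Let $\mathbf{f} : \mathbb{R}^n \times \mathbb{R}^{n_u} \times \mathbb{R}^{n_p} \times \mathbb{R}^{n_w} \to \mathbb{R}^n$ be of class $\mathcal{C}^1$ and, for $k \ge 1$, let $\mathbf{x}_k = \mathbf{f}(\mathbf{x}_{k-1},\mathbf{u}_{k-1},\mathbf{p},\mathbf{w}_{k-1})$, where: (i) $\mathbf{u}_{k-1}\in\mathbb{R}^{n_u}$; (ii) $\mathbf{w}_{k-1}\in W$, with $W=\{\mathbf{G}_w,\mathbf{c}_w,\mathbf{A}_w,\mathbf{b}_w\}\subset\mathbb{R}^{n_w}$ a constrained zonotope; (iii) $\mathbf{p}\in P$, with $P\subset\mathbb{R}^{n_p}$ a constrained zonotope; (iv) $\mathbf{z}_{k-1}=(\mathbf{x}_{k-1},\mathbf{p})\in\hat Z_{k-1}$, with $\hat Z_{k-1}=\{\hat{\mathbf{G}}_{k-1},\hat{\mathbf{c}}_{k-1},\hat{\mathbf{A}}_{k-1},\hat{\mathbf{b}}_{k-1}\}\subset\mathbb{R}^{n+n_p}$ a constrained zonotope. Choose any $\boldsymbol{\gamma}_z=(\boldsymbol{\gamma}_x,\boldsymbol{\gamma}_p)\in\square\hat Z_{k-1}$, with $\boldsymbol{\gamma}_x\in\mathbb{R}^n$ and $\boldsymbol{\gamma}_p\in\mathbb{R}^{n_p}$. Let $Z_w\subset\mathbb{R}^n$ be a constrained zonotope such that $\mathbf{f}(\boldsymbol{\gamma}_x,\mathbf{u}_{k-1},\boldsymbol{\gamma}_p,\mathbf{w})\in Z_w$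 for all $\mathbf{w}\in W$, and let $\mathbf{J}_z\in\mathbb{IR}^{n\times(n+n_p)}$ be an interval matrix such that $\nabla_z^T\mathbf{f}(\mathbf{x},\mathbf{u}_{k-1},\mathbf{q},\mathbf{w})\in\mathbf{J}_z$ for all $(\mathbf{x},\mathbf{q})\in\square\hat Z_{k-1}$ and all $\mathbf{w}\in W$. If $\{\underline{\hat{\mathbf{G}}},\underline{\hat{\mathbf{c}}}\}\subset\mathbb{R}^{n+n_p}$ is a zonotope with $\underline{n}_g$ generators satisfying $\hat Z_{k-1}-\boldsymbol{\gamma}_z\subseteq\{\underline{\hat{\mathbf{G}}},\underline{\hat{\mathbf{c}}}\}$, then $(\mathbf{x}_k,\mathbf{p})\in\bar Z_k$, where $$\bar Z_k=\begin{bmatrix}\mathbf{H}\\ \mathbf{E}\end{bmatrix}\hat Z_{k-1}\oplus\begin{bmatrix}\mathbf{H}\\ \mathbf{0}\end{bmatrix}(-\boldsymbol{\gamma}_z)\oplus\begin{bmatrix}\hat{\mathbf{P}}\\ \mathbf{0}\end{bmatrix}B_\infty^n\oplus\begin{bmatrix}\mathbf{I}\\ \mathbf{0}\end{bmatrix}Z_w\subset\mathbb{R}^{n+n_p},$$ with $\mathbf{E}=[\mathbf{0}_{n_p\times n}\;\;\mathbf{I}_{n_p}]$, $\mathbf{H}=\mathrm{mid}(\mathbf{J}_z)$, the interval vector $\mathbf{m}=(\mathbf{J}_z-\mathrm{mid}(\mathbf{J}_z))\,\underline{\hat{\mathbf{c}}}\in\mathbb{IR}^n$, and $\hat{\mathbf{P}}\in\mathbb{R}^{n\times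 n}$ the diagonal matrix with $$\hat P_{ii}=\mathrm{rad}(m_i)+\sum_{j=1}^{\underline{n}_g}\sum_{\ell=1}^{n+n_p}\mathrm{rad}(J_{z,i\ell})\,|\underline{\hat G}_{\ell j}|,\qquad i=1,\dots,n.$$
   Context: Constrained zonotopes: a set $Z\subset\mathbb{R}^d$ is a constrained zonotope, written $Z=\{\mathbf{G},\mathbf{c},\mathbf{A},\mathbf{b}\}$, if there are $\mathbf{G}\in\mathbb{R}^{d\times n_g}$, $\mathbf{c}\in\mathbb{R}^d$, $\mathbf{A}\in\mathbb{R}^{n_c\times n_g}$, $\mathbf{b}\in\mathbb{R}^{n_c}$ with $Z=\{\mathbf{c}+\mathbf{G}\boldsymbol{\xi}:\|\boldsymbol{\xi}\|_\infty\le1,\ \mathbf{A}\boldsymbol{\xi}=\mathbf{b}\}$. A zonotope with $n_g$ generators, written $\{\mathbf{G},\mathbf{c}\}$, is a set $\{\mathbf{c}+\mathbf{G}\boldsymbol{\xi}:\|\boldsymbol{\xi}\|_\infty\le1\}$ with $\mathbf{G}$ having $n_g$ columns. $B_\infty^n=\{\boldsymbol{\xi}\in\mathbb{R}^n:\|\boldsymbol{\xi}\|_\infty\le1\}$. Set operations: $\mathbf{R}Z=\{\mathbf{R}\mathbf{z}:\mathbf{z}\in Z\}$ for a real matrix $\mathbf{R}$; $Z\oplus W=\{\mathbf{z}+\mathbf{w}:\mathbf{z}\in Z,\mathbf{w}\in W\}$ (a vector is identified with the corresponding singleton); $Z-\boldsymbol{\gamma}=\{\mathbf{z}-\boldsymbol{\gamma}:\mathbf{z}\in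 Z\}$. For bounded $Z$, $\square Z$ is the interval hull, i.e. the smallest box (product of compact intervals) containing $Z$. Intervals: $\mathbb{IR}$ is the set of compact real intervals; for $X=[x^L,x^U]$, $\mathrm{mid}(X)=\tfrac12(x^U+x^L)$ and $\mathrm{rad}(X)=\tfrac12(x^U-x^L)$. $\mathbb{IR}^{n\times m}$ is the set of $n\times m$ matrices with interval entries; mid and rad are taken entrywise, and a real matrix $\hat{\mathbf{J}}$ belongs to an interval matrix $\mathbf{J}$ if $\hat J_{ij}\in J_{ij}$ for all $i,j$. Products of an interval matrix and a real vector, and differences of an interval matrix and a real matrix, are evaluated by interval arithmetic; thus $m_i$ is the interval centered at $0$ with $\mathrm{rad}(m_i)=\sum_\ell\mathrm{rad}(J_{z,i\ell})|\underline{\hat c}_\ell|$. $\nabla_z^T\mathbf{f}$ denotes the $n\times(n+n_p)$ Jacobian matrix of $\mathbf{f}(\mathbf{x},\mathbf{u},\mathbf{p},\mathbf{w})$ with respect to $\mathbf{z}=(\mathbf{x},\mathbf{p})$. *)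

(* Defs.v *)
From mathcomp Require Import all_boot all_order all_algebra.
From mathcomp Require Import all_classical all_reals.
From mathcomp Require Import topology normedtype derive.

Set Implicit Arguments.
Unset Strict Implicit.
Unset Printing Implicit Defensive.

Import Order.TTheory GRing.Theory Num.Theory.
Import numFieldNormedType.Exports.

Local Open Scope classical_set_scope.
Local Open Scope ring_scope.

Record cint (R : realType) := CInt {
  cint_lo : R;
  cint_hi : R;
  cint_lohi : cint_lo <= cint_hi }.

Section IntervalArithmetic.
Variable R : realType.
Implicit Types (x a : R) (X Y : cint R).

Definition cint_in x X : bool := cint_lo X <= x <= cint_hi X.

Definition cint_mid X : R := 2^-1 * (cint_hi X + cint_lo X).
Definition cint_rad X : R := 2^-1 * (cint_hi X - cint_lo X).

Definition cint_cst a : cint R := CInt (lexx a).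

Definition cint_add X Y : cint R :=
  CInt (lerD (cint_lohi X) (cint_lohi Y)).

Definition cint_sub X Y : cint R :=
  CInt (lerB (cint_lohi X) (cint_lohi Y)).

Fact cint_scale_subproof a X :
  Num.min (cint_lo X * a) (cint_hi X * a) <=
    Num.max (cint_lo X * a) (cint_hi X * a).
Proof. by rewrite ge_min !le_max lexx. Qed.

(* The exact range {x * a : x in X}; the endpoints swap when a < 0. *)
Definition cint_scale X a : cint R := CInt (cint_scale_subproof a X).

Variables m n : nat.

Definition imx_in (A : 'M[R]_(m, n)) (J : 'M[cint R]_(m, n)) : Prop :=
  forall i j, cint_in (A i j) (J i j).

Definition imx_mid (J : 'M[cint R]_(m, n)) : 'M[R]_(m, n) :=
  \matrix_(i, j) cint_mid (J i j).

Definition imx_sub (J : 'M[cint R]_(m, n)) (A : 'M[R]_(m, n)) :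
    'M[cint R]_(m, n) :=
  \matrix_(i, j) cint_sub (J i j) (cint_cst (A i j)).

Definition imx_mulv (J : 'M[cint R]_(m, n)) (v : 'cV[R]_n) : 'cV[cint R]_m :=
  \col_i \big[cint_add/cint_cst 0]_(l < n) cint_scale (J i l) (v l 0).

End IntervalArithmetic.

(* The library norm on matrices is the max norm, hence `|xi| is the
   infinity norm of xi (with value 0 in dimension 0). *)
Definition Binf (R : realType) (n : nat) : set 'cV[R]_n := [set xi | `|xi| <= 1].
Arguments Binf {R} n.

Section Sets.
Variable R : realType.

Definition zonotope (d ng : nat) (G : 'M[R]_(d, ng)) (c : 'cV[R]_d) :
    set 'cV[R]_d :=
  [set c + G *m xi | xi in Binf ng].

Definition czonotope (d ng nc : nat) (G : 'M[R]_(d, ng)) (c : 'cV[R]_d)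
    (A : 'M[R]_(nc, ng)) (b : 'cV[R]_nc) : set 'cV[R]_d :=
  [set c + G *m xi | xi in [set xi | Binf ng xi /\ A *m xi = b]].

Definition is_czonotope (d : nat) (Z : set 'cV[R]_d) : Prop :=
  exists (ng nc : nat) (G : 'M[R]_(d, ng)) (c : 'cV[R]_d)
         (A : 'M[R]_(nc, ng)) (b : 'cV[R]_nc),
    Z = czonotope G c A b.

Definition minkowski_sum (d : nat) (Z W : set 'cV[R]_d) : set 'cV[R]_d :=
  [set z + w | z in Z & w in W].

Definition lin_image (d e : nat) (M : 'M[R]_(e, d)) (Z : set 'cV[R]_d) :
    set 'cV[R]_e :=
  [set M *m z | z in Z].

Definition is_box (d : nat) (B : set 'cV[R]_d) : Prop :=
  exists X : 'cV[cint R]_d, B = [set z | imx_in z X].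

(* [smallest] is the intersection of all boxes containing Z; when Z is nonempty
   and bounded, as intended, this intersection is itself a box. *)
Definition interval_hull (d : nat) (Z : set 'cV[R]_d) : set 'cV[R]_d :=
  smallest (@is_box d) Z.

End Sets.

Notation "Z (+) W" := (minkowski_sum Z W) (at level 50, left associativity) :
  classical_set_scope.

(* Continuous differentiability: the differential exists everywhere and depends
   continuously on the point for the operator norm. *)
Definition class_C1 (R : realType) (V W : normedModType R) (f : V -> W) : Prop :=
  (forall x, differentiable f x) /\
  forall (x : V) (e : R), 0 < e ->
    \forall y \near x, forall h, `|'d f y h - 'd f x h| <= e * `|h|.

(* The entry (i, j) is the partial derivative of the i-th component of
   f(x, u, p, w) with respect to the j-th coordinate of z = (x, p). *)
Definition jacobian_z (R : realType) (n nu np nw : nat)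
    (f : 'cV[R]_n * 'cV[R]_nu * 'cV[R]_np * 'cV[R]_nw -> 'cV[R]_n)
    (x : 'cV[R]_n) (u : 'cV[R]_nu) (p : 'cV[R]_np) (w : 'cV[R]_nw) :
    'M[R]_(n, n + np) :=
  \matrix_(i, j)
    'D_(delta_mx j 0)
      (fun z : 'cV[R]_(n + np) => f (usubmx z, u, dsubmx z, w) i 0 : R)
      (col_mx x p).

(* Main.v *)
(* Componentwise mean value theorem along the segment from gamma_z to z, which
   stays in the (convex) interval hull: f_i(z) - f_i(gamma_z) = M_i (z - gamma_z)
   with M the Jacobian at an i-dependent point, so M in J. Subtracting
   H (z - gamma_z) leaves (M - mid J)_i (z - gamma_z), bounded by Phat_ii because
   z - gamma_z = cu + Gu xi with |xi| <= 1. *)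
Require Import Defs.
From mathcomp Require Import all_boot all_order all_algebra.
From mathcomp Require Import all_classical all_reals.
From mathcomp Require Import topology normedtype derive.
From mathcomp Require Import ring lra.

Set Implicit Arguments.
Unset Strict Implicit.
Unset Printing Implicit Defensive.

Import Order.TTheory GRing.Theory Num.Theory.
Import numFieldNormedType.Exports.

Local Open Scope classical_set_scope.
Local Open Scope ring_scope.

(** Restricting [phi] to the line [ell t = a + t *: v] gives a real function whose derivative at [t]
    is ['d phi (ell t) v] by the chain rule; the one-variable theorem on [0, 1] then applies. *)
Lemma mean_value (R : realType) (V : normedModType R) (phi : V -> R) (a v : V) :
  (forall y, differentiable phi y) ->
  exists2 t, 0 < t < 1 & phi (a + v) - phi a = 'd phi (a + t *: v) v.
Proof.
move=> dphi.
pose ell (t : R) : V := a + t *: v.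
have dell t : is_diff t ell (fun h => h *: v).
  by apply: is_diff_eq; rewrite add0r.
have dpsi (t : R) : is_derive t 1 (phi \o ell) ('d phi (ell t) v).
  have dc : differentiable (phi \o ell) t by apply: differentiable_comp.
  apply: DeriveDef; first exact: diff_derivable.
  by rewrite deriveE// diff_comp//= diff_val scale1r.
have [|t] := MVT (ltr01 : 0 < 1 :> R) (fun t _ => dpsi t).
  apply: continuous_subspaceT => t.
  by apply: differentiable_continuous; apply: differentiable_comp.
rewrite in_itv /= /ell scale1r scale0r addr0 subr0 mulr1 => t01 eqt.
by exists t.
Qed.

(** Linearity of the differential along the standard basis; this brings in the partial derivatives
    that are the entries of [jacobian_z]. *)
Lemma diff_cV_sum (R : realType) (d : nat) (phi : 'cV[R]_d -> R)
    (y v : 'cV[R]_d) : differentiable phi y ->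
  'd phi y v = \sum_l 'D_(delta_mx l 0) phi y * v l 0.
Proof.
move=> dphi; rewrite {1}(matrix_sum_delta v) linear_sum /=.
by apply: eq_bigr => l _; rewrite big_ord1 linearZ /= deriveE// mulrC.
Qed.

(** The norm is a maximum started at 0, so [0 <= r] is what settles the case of an empty matrix. *)
Lemma mx_norm_leP (R : realType) (m n : nat) (M : 'M[R]_(m, n)) (r : R) :
  0 <= r -> reflect (forall i j, `|M i j| <= r) (`|M| <= r).
Proof.
move=> r0; rewrite [`|M|]/Num.norm /= mx_normrE.
apply: (iffP (bigmax_leP _ _ _ _)) => [[_ Mr] i j|Mr]; first exact: (Mr (i, j)).
by split=> // -[].
Qed.

Lemma mx_norm_coord_le (R : realType) (m n : nat) (M : 'M[R]_(m, n)) i j :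
  `|M i j| <= `|M|.
Proof. by move: i j; apply/mx_norm_leP. Qed.

(** A nonexpansive linear map is bounded, hence continuous, hence differentiable. The block
    projections [usubmx] and [dsubmx] are of this kind for the max norm. *)
Lemma differentiable_bounded_linear (R : realType) (V W : normedModType R)
    (g : {linear V -> W}) (y : V) :
  (forall x, `|g x| <= `|x|) -> differentiable g y.
Proof.
move=> g1; apply/linear_differentiable/bounded_linear_continuous.
apply/linear_boundedP; near=> r => x.
rewrite (le_trans (g1 x))// ler_peMl//; near: r; exact: nbhs_pinfty_ge.
Unshelve. all: by end_near. Qed.

Lemma differentiable_usubmx (R : realType) (m1 m2 n : nat)
    (y : 'M[R]_(m1 + m2, n)) :
  differentiable (usubmx : 'M[R]_(m1 + m2, n) -> 'M[R]_(m1, n)) y.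
Proof.
apply: differentiable_bounded_linear => M.
by apply/mx_norm_leP => // i j; rewrite mxE mx_norm_coord_le.
Qed.

Lemma differentiable_dsubmx (R : realType) (m1 m2 n : nat)
    (y : 'M[R]_(m1 + m2, n)) :
  differentiable (dsubmx : 'M[R]_(m1 + m2, n) -> 'M[R]_(m2, n)) y.
Proof.
apply: differentiable_bounded_linear => M.
by apply/mx_norm_leP => // i j; rewrite mxE mx_norm_coord_le.
Qed.

(** The scalar mean value theorem is applied to one component, with [u] and [w] frozen. Since [t]
    depends on [i], in general no single Jacobian serves all rows. *)
Lemma jacobian_z_mean_value (R : realType) (n nu np nw : nat)
    (f : 'cV[R]_n * 'cV[R]_nu * 'cV[R]_np * 'cV[R]_nw -> 'cV[R]_n)
    (u : 'cV[R]_nu) (w : 'cV[R]_nw) (a v : 'cV[R]_(n + np)) (i : 'I_n) :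
  (forall y, differentiable f y) ->
  exists2 t, 0 < t < 1 &
    let y := a + t *: v in
    (f (usubmx (a + v), u, dsubmx (a + v), w) - f (usubmx a, u, dsubmx a, w)) i 0
    = (jacobian_z f (usubmx y) u (dsubmx y) w *m v) i 0.
Proof.
move=> df.
pose phi (z : 'cV[R]_(n + np)) : R := f (usubmx z, u, dsubmx z, w) i 0.
(* [phi] is the embedding of [z] into the arguments of [f], followed by [f] and a coordinate
   projection. *)
have dphi y : differentiable phi y.
  apply: (@differentiable_comp _ _ _ _
    (fun z : 'cV[R]_(n + np) => f (usubmx z, u, dsubmx z, w))
    (fun M : 'cV[R]_n => M i 0)); last exact: differentiable_coord.
  apply: (@differentiable_comp _ _ _ _
    (fun z : 'cV[R]_(n + np) => (usubmx z, u, dsubmx z, w))) => //.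
  apply: differentiable_pair => //.
  apply: differentiable_pair; last exact: differentiable_dsubmx.
  by apply: differentiable_pair; first exact: differentiable_usubmx.
have [t t01 eqt] := mean_value a v dphi.
exists t => //=; rewrite !mxE -/(phi _) -/(phi _) eqt diff_cV_sum//.
by apply: eq_bigr => l _; rewrite mxE vsubmxK.
Qed.

(** The hull is an intersection of boxes, so it suffices to check each box, coordinate by
    coordinate. *)
Lemma interval_hull_convex (R : realType) (d : nat) (Z : set 'cV[R]_d)
    (a v : 'cV[R]_d) (t : R) :
  0 <= t <= 1 -> interval_hull Z a -> interval_hull Z (a + v) ->
  interval_hull Z (a + t *: v).
Proof.
move=> /andP[t0 t1] Za Zav B [[X ->] ZB]/= i j.
have /(_ i j) := Za _ (conj (ex_intro _ X erefl) ZB).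
have /(_ i j) := Zav _ (conj (ex_intro _ X erefl) ZB).
rewrite /cint_in !mxE => /andP[? ?] /andP[? ?]; apply/andP; split; nra.
Qed.

Lemma cint_rad_ge0 (R : realType) (X : cint R) : 0 <= cint_rad X.
Proof. by rewrite mulr_ge0// ?invr_ge0// subr_ge0 cint_lohi. Qed.

Lemma cint_in_mid_rad (R : realType) (X : cint R) (a : R) :
  cint_in a X -> `|a - cint_mid X| <= cint_rad X.
Proof.
rewrite /cint_in /cint_mid /cint_rad ler_norml => /andP[? ?].
by apply/andP; split; lra.
Qed.

Lemma cint_rad_add (R : realType) (X Y : cint R) :
  cint_rad (cint_add X Y) = cint_rad X + cint_rad Y.
Proof. by rewrite /cint_rad /=; ring. Qed.

Lemma cint_rad_cst (R : realType) (a : R) : cint_rad (cint_cst a) = 0.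
Proof. by rewrite /cint_rad /= subrr mulr0. Qed.

Lemma cint_rad_sub_cst (R : realType) (X : cint R) (a : R) :
  cint_rad (cint_sub X (cint_cst a)) = cint_rad X.
Proof. by rewrite /cint_rad /=; ring. Qed.

Lemma cint_rad_scale (R : realType) (X : cint R) (a : R) :
  cint_rad (cint_scale X a) = cint_rad X * `|a|.
Proof.
have XX := cint_lohi X; rewrite /cint_rad /=.
have [a0|/ltW a0] := ger0P a.
  by rewrite min_l ?max_r ?ler_wpM2r//; ring.
by rewrite min_r ?max_l ?ler_wnM2r//; ring.
Qed.

Lemma cint_rad_sum (R : realType) (d : nat) (X : 'I_d -> cint R) :
  cint_rad (\big[@cint_add R/cint_cst 0]_l X l) = \sum_l cint_rad (X l).
Proof. exact: (big_morph _ (@cint_rad_add R) (cint_rad_cst 0)). Qed.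

(** Subtracting a real matrix only shifts the intervals, so [A] disappears; radii then scale by
    absolute values and add up. *)
Lemma cint_rad_imx_mulv_sub (R : realType) (m n : nat) (J : 'M[cint R]_(m, n))
    (A : 'M[R]_(m, n)) (v : 'cV[R]_n) (i : 'I_m) :
  cint_rad (imx_mulv (imx_sub J A) v i 0) =
  \sum_l cint_rad (J i l) * `|v l 0|.
Proof.
rewrite mxE cint_rad_sum; apply: eq_bigr => l _.
by rewrite cint_rad_scale mxE cint_rad_sub_cst.
Qed.

Lemma zonotope_coord_le (R : realType) (d ng : nat) (G : 'M[R]_(d, ng))
    (c v : 'cV[R]_d) (l : 'I_d) :
  zonotope G c v -> `|v l 0| <= `|c l 0| + \sum_j `|G l j|.
Proof.
move=> [xi /mx_norm_leP xi1 <-]; rewrite !mxE.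
rewrite (le_trans (ler_normD _ _))// lerD2l.
rewrite (le_trans (ler_norm_sum _ _ _))// ler_sum// => j _.
by rewrite normrM ler_piMr// xi1.
Qed.

(** A diagonal matrix stretches the unit box to half-widths [d 0 i], so componentwise bounds suffice
    for membership; the preimage is found by dividing. *)
Lemma diag_mx_Binf (R : realType) (n : nat) (d : 'rV[R]_n) (r : 'cV[R]_n) :
  (forall i, `|r i 0| <= d 0 i) ->
  lin_image (diag_mx d) (Binf n) r.
Proof.
move=> rd; exists (\col_i (r i 0 / d 0 i)).
  apply/mx_norm_leP => // i j; rewrite mxE.
  have d0 : 0 <= d 0 i by rewrite (le_trans _ (rd i)).
  (* If d_i = 0 then r_i = 0, and r_i / d_i = 0 is a valid witness. *)
  have [->|dn0] := eqVneq (d 0 i) 0; first by rewrite invr0 mulr0 normr0.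
  rewrite normrM normfV (ger0_norm d0) ler_pdivrMr ?mul1r//.
  by rewrite lt_def dn0.
apply/matrixP => i j; rewrite ord1 mul_diag_mx !mxE.
have [d0|dn0] := eqVneq (d 0 i) 0; last by rewrite mulrC divfK.
by have := rd i; rewrite d0 normr_le0 mul0r => /eqP ->.
Qed.

Lemma mean_value_remainder_le (R : realType) (m d ng : nat)
    (J : 'M[cint R]_(m, d)) (M : 'M[R]_(m, d)) (G : 'M[R]_(d, ng))
    (c v : 'cV[R]_d) (i : 'I_m) :
  imx_in M J -> zonotope G c v ->
  `|((M - imx_mid J) *m v) i 0| <=
    cint_rad (imx_mulv (imx_sub J (imx_mid J)) c i 0) +
    \sum_j \sum_l cint_rad (J i l) * `|G l j|.
Proof.
(* Exchanging the double sum turns the bound into one sum over [l], with terms [cint_rad (J i l)]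
   times the bound of [zonotope_coord_le] on the coordinate [l] of [v]. *)
move=> MJ Gv; rewrite cint_rad_imx_mulv_sub exchange_big -big_split mxE /=.
rewrite (le_trans (ler_norm_sum _ _ _))// ler_sum// => l _.
rewrite -mulr_sumr -mulrDr normrM ler_pM//; last exact: zonotope_coord_le.
by rewrite !mxE cint_in_mid_rad.
Qed.

Theorem corollary1 (R : realType) (n nu np nw : nat)
  (f : 'cV[R]_n * 'cV[R]_nu * 'cV[R]_np * 'cV[R]_nw -> 'cV[R]_n)
  (f_C1 : class_C1 f)
  (x : nat -> 'cV[R]_n) (u : nat -> 'cV[R]_nu)
  (p : 'cV[R]_np) (w : nat -> 'cV[R]_nw)
  (k : nat) (k_ge1 : (1 <= k)%N)
  (xkE : x k = f (x k.-1, u k.-1, p, w k.-1))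
  (ngw ncw : nat) (Gw : 'M[R]_(nw, ngw)) (cw : 'cV[R]_nw)
  (Aw : 'M[R]_(ncw, ngw)) (bw : 'cV[R]_ncw)
  (W : set 'cV[R]_nw) (WE : W = czonotope Gw cw Aw bw)
  (wW : W (w k.-1))
  (P : set 'cV[R]_np) (P_cz : is_czonotope P) (pP : P p)
  (ng nc : nat) (G : 'M[R]_(n + np, ng)) (c : 'cV[R]_(n + np))
  (A : 'M[R]_(nc, ng)) (b : 'cV[R]_nc)
  (Z : set 'cV[R]_(n + np)) (ZE : Z = czonotope G c A b)
  (zZ : Z (col_mx (x k.-1) p))
  (gx : 'cV[R]_n) (gp : 'cV[R]_np)
  (g_hull : interval_hull Z (col_mx gx gp))
  (Zw : set 'cV[R]_n) (Zw_cz : is_czonotope Zw)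
  (fZw : forall v, W v -> Zw (f (gx, u k.-1, gp, v)))
  (J : 'M[cint R]_(n, n + np))
  (fJ : forall (y : 'cV[R]_n) (q : 'cV[R]_np) (v : 'cV[R]_nw),
    interval_hull Z (col_mx y q) -> W v ->
    imx_in (jacobian_z f y (u k.-1) q v) J)
  (ngu : nat) (Gu : 'M[R]_(n + np, ngu)) (cu : 'cV[R]_(n + np))
  (Zu : [set z - col_mx gx gp | z in Z] `<=` zonotope Gu cu) :
  let E : 'M[R]_(np, n + np) := row_mx 0 1%:M in
  let H : 'M[R]_(n, n + np) := imx_mid J in
  let m : 'cV[cint R]_n := imx_mulv (imx_sub J (imx_mid J)) cu in
  let Phat : 'M[R]_n := diag_mx (\row_i (cint_rad (m i 0) +
    \sum_(j < ngu) \sum_(l < n + np) cint_rad (J i l) * `|Gu l j|)) in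
  let Zbar : set 'cV[R]_(n + np) :=
    lin_image (col_mx H E) Z
    (+) [set col_mx H (0 : 'M[R]_(np, n + np)) *m (- col_mx gx gp)]
    (+) lin_image (col_mx Phat (0 : 'M[R]_(np, n))) (Binf n)
    (+) lin_image (col_mx (1%:M : 'M[R]_n) (0 : 'M[R]_(np, n))) Zw in
  Zbar (col_mx (x k) p).
Proof.
move=> E H m Phat Zbar.
set g := col_mx gx gp in g_hull Zu Zbar *.
set z := col_mx (x k.-1) p in zZ.
(* The linearization error about [g], which the summand with [Phat] has to absorb. *)
pose r := x k - f (gx, u k.-1, gp, w k.-1) - H *m (z - g).
have zhull : interval_hull Z z by exact: sub_gen_smallest.
have zu : zonotope Gu cu (z - g) by apply: Zu; exists z.
have [xi xi1 Pxi] : lin_image Phat (Binf n) r.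
  apply: diag_mx_Binf => i; rewrite [leRHS]mxE.
  have [t /andP[t0 t1]] :=
    jacobian_z_mean_value (u k.-1) (w k.-1) g (z - g) i f_C1.1.
  set y := g + t *: (z - g); rewrite /= subrKC !col_mxKu !col_mxKd -xkE => eqt.
  set M := jacobian_z _ _ _ _ _ in eqt.
  have -> : r i 0 = ((M - H) *m (z - g)) i 0.
    by rewrite mulmxBl [LHS]mxE [RHS]mxE eqt.
  (* The enclosure [fJ] holds on the hull only; convexity places the intermediate point [y]
     there. *)
  apply: mean_value_remainder_le => //; apply: fJ => //.
  by rewrite vsubmxK; apply: interval_hull_convex; rewrite ?subrKC// !ltW.
(* One point is chosen in each summand. The upper blocks add up to [H *m (z - g) + r + f (gx, u
   k.-1, gp, w k.-1)], which is [x k] by the choice of [r]; the lower block is [E *m z], that is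
   [p]. *)
exists (col_mx H E *m z + col_mx H 0 *m (- g) + col_mx Phat 0 *m xi).
  exists (col_mx H E *m z + col_mx H 0 *m (- g)).
    by exists (col_mx H E *m z); [exists z|exists (col_mx H 0 *m (- g))].
  by exists (col_mx Phat 0 *m xi) => //; exists xi.
exists (col_mx 1%:M 0 *m f (gx, u k.-1, gp, w k.-1)).
  by exists (f (gx, u k.-1, gp, w k.-1)) => //; exact: fZw.
rewrite !mul_col_mx Pxi !mul0mx mul1mx !add_col_mx !addr0.
rewrite -mulmxDr mul_row_col mul0mx mul1mx add0r.
by rewrite /r [X in col_mx (X + _) _]addrC !subrK.
Qed.
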